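(* Let $G=(V,E)$ be an arbitrary finite graph. Define a metric on $V$ as follows: the distance between two (distinct) vertices of $G$ is equal to $a$ if and only if they are adjacent in $G$, otherwise it equals $b$, with $a<b\le 2a$. Let $m$ be the greatest positive integer such that $2d_{GH}(a\Delta,V)=b$, where $a\Delta$ is a simplex consisting of $m$ vertices. Then $\theta(G)=m+1$.
   Context: Graphs are simple. A simplex is a metric space all of whose non-zero distances are the same; $a\Delta$ denotes a simplex whose non-zero distances equal $a>0$ (a one-point space if it consists of one vertex). $d_{GH}$ denotes the Gromov--Hausdorff distance: $d_{GH}(X,Y)$ is the infimum of all real $r$ for which there exist a metric space $Z$ and subsets $X',Y'\subset Z$ isometric to $X$ and $Y$ respectively with Hausdorff distance $d_H(X',Y')\le r$. A clique in a simple graph $H$ is a subgraph any two vertices of which are connected by an edge (single-vertex subgraphs are cliques). The clique covering number $\theta(H)$ is the minimal possible number of cliques covering all vertices of $H$; equivalently, the least number of cliques whose vertex sets partition the vertex set of $H$. *)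

(* Defs.v *)
From HB Require Import structures.
From mathcomp Require Import all_boot all_order all_algebra.
From mathcomp Require Import all_classical all_reals ereal topology.
From mathcomp Require Import lra.

Set Implicit Arguments.
Unset Strict Implicit.
Unset Printing Implicit Defensive.

Import Order.TTheory GRing.Theory Num.Theory.

Local Open Scope ring_scope.

Record sgraph := SGraph {
  vertex :> finType;
  adj : rel vertex;
  adj_sym : symmetric adj;
  adj_irrefl : irreflexive adj }.

Definition clique (G : sgraph) (A : {set G}) : bool :=
  (A != finset.set0) &&
  [forall x in A, forall y in A, (x != y) ==> adj x y].

Definition clique_cover (G : sgraph) (P : {set {set G}}) : bool :=
  [forall A in P, clique A] && (finset.cover P == [set: G]%SET).

Definition has_clique_cover (G : sgraph) (k : nat) : bool :=
  [exists P : {set {set G}}, clique_cover P && (#|P| == k)].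

Lemma ex_clique_cover (G : sgraph) : exists k, has_clique_cover G k.
Proof.
exists #|[set [set x]%SET | x : G]%SET|; apply/existsP.
exists [set [set x]%SET | x : G]%SET; rewrite eqxx andbT; apply/andP; split.
  apply/forall_inP => A /imsetP[x _ ->]; apply/andP; split.
    by apply/set0Pn; exists x; rewrite finset.in_set1.
  apply/forall_inP => y /set1P ->; apply/forall_inP => z /set1P ->.
  by rewrite eqxx.
apply/eqP/setP => x; rewrite finset.in_setT; apply/bigcupP.
exists [set x]%SET; last by rewrite finset.in_set1.
by apply/imsetP; exists x.
Qed.

(** The clique covering number [theta(G)]. *)
Definition theta (G : sgraph) : nat := ex_minn (ex_clique_cover G).

(** The simplex [a Delta] on [m] vertices. *)
Definition simplex (R : realType) (a : R) (a_gt0 : 0 < a) (m : nat) : Type :=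
  'I_m.

Section SimplexMetric.
Context (R : realType) (a : R) (a_gt0 : 0 < a) (m : nat).
Local Notation T := (simplex a_gt0 m).

HB.instance Definition _ := Finite.on T.

Definition simplex_dist (x y : T) : R := if x == y then 0 else a.

Lemma simplex_distxx x : simplex_dist x x = 0.
Proof. by rewrite /simplex_dist eqxx. Qed.

Lemma simplex_dist_eq0 x y : simplex_dist x y = 0 -> x = y.
Proof.
rewrite /simplex_dist; case: eqP => // _ aE.
by have := a_gt0; rewrite [X in 0 < X]aE ltxx.
Qed.

Lemma simplex_dist_sym x y : simplex_dist x y = simplex_dist y x.
Proof. by rewrite /simplex_dist eq_sym. Qed.

Lemma simplex_dist_triangle y x z :
  simplex_dist x z <= simplex_dist x y + simplex_dist y z.
Proof.
have a0 := a_gt0; rewrite /simplex_dist.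
case: (eqVneq x y) => [->|_]; first by rewrite add0r.
by case: (x == z); case: (y == z); lra.
Qed.

HB.instance Definition _ := @isMetric.Build R T simplex_dist
  simplex_distxx simplex_dist_eq0 simplex_dist_sym simplex_dist_triangle.

End SimplexMetric.

(** The vertex set of [G] with distance [a] between adjacent vertices and [b]
    between distinct non-adjacent ones. *)
Definition graph_space (R : realType) (G : sgraph) (a b : R)
  (a_gt0 : 0 < a) (ab : a < b <= 2 * a) : Type := vertex G.

Section GraphMetric.
Context (R : realType) (G : sgraph) (a b : R).
Context (a_gt0 : 0 < a) (ab : a < b <= 2 * a).
Local Notation V := (graph_space G a_gt0 ab).

HB.instance Definition _ := Finite.on V.

Definition graph_dist (x y : V) : R :=
  if x == y then 0 else if @adj G x y then a else b.

Lemma graph_distxx x : graph_dist x x = 0.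
Proof. by rewrite /graph_dist eqxx. Qed.

Lemma graph_dist_eq0 x y : graph_dist x y = 0 -> x = y.
Proof.
have a0 := a_gt0; have /andP[ab1 ab2] := ab.
by rewrite /graph_dist; case: eqP => // _; case: ifP => _ ?; exfalso; lra.
Qed.

Lemma graph_dist_sym x y : graph_dist x y = graph_dist y x.
Proof. by rewrite /graph_dist eq_sym adj_sym. Qed.

Lemma graph_dist_triangle y x z :
  graph_dist x z <= graph_dist x y + graph_dist y z.
Proof.
have a0 := a_gt0; have /andP[ab1 ab2] := ab; rewrite /graph_dist.
case: (eqVneq x y) => [->|xy]; first by rewrite add0r.
case: (eqVneq y z) => [<-|yz]; first by rewrite (negbTE xy) addr0.
by case: (x == z); case: (adj x z); case: (adj x y); case: (adj y z); lra.
Qed.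

HB.instance Definition _ := @isMetric.Build R V graph_dist
  graph_distxx graph_dist_eq0 graph_dist_sym graph_dist_triangle.

End GraphMetric.

Section GromovHausdorff.
Local Open Scope classical_set_scope.
Local Open Scope ereal_scope.
Context {R : realType}.

Definition nbhd {Z : metricType R} (A : set Z) (r : R) : set Z :=
  \bigcup_(x in A) ball x r.

(** Valued in the extended reals: it is [+oo] when no radius works, e.g. when
    exactly one of the two sets is empty. *)
Definition hausdorff_dist {Z : metricType R} (A B : set Z) : \bar R :=
  ereal_inf [set r%:E | r in
    [set r : R | [/\ (0 < r)%R, A `<=` nbhd B r & B `<=` nbhd A r]]].

Definition isometric_to {Z : metricType R} (A : set Z) (X : metricType R) :=
  exists2 f : X -> Z, (forall x y, mdist (f x) (f y) = mdist x y)
                    & range f = A.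

Definition gromov_hausdorff_dist (X Y : metricType R) : \bar R :=
  ereal_inf [set r%:E | r in
    [set r : R | exists (Z : metricType R) (X' Y' : set Z),
      [/\ isometric_to X' X, isometric_to Y' Y
        & hausdorff_dist X' Y' <= r%:E]]].

End GromovHausdorff.

(* Main.v *)
Require Import Defs.
From HB Require Import structures.
From mathcomp Require Import all_boot all_order all_algebra.
From mathcomp Require Import all_classical all_reals ereal topology.
From mathcomp Require Import lra.

Import Order.TTheory GRing.Theory Num.Theory.
Local Open Scope ring_scope.

(** The Gromov-Hausdorff distance is half the least distortion of a relation
    between [aDelta] and [V] that is total on both sides. Such a relation
    amounts to a cover of [V] by the [k] nonempty fibers [C i] of the points of
    the simplex. Distinct points [i], [j] of the simplex contribute at most [a]
    to the distortion, since distances in [V] lie in [[0, 2a]], so only the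
    diameters of the fibers matter:

    - if [k < theta G], the [C i] cannot all be cliques, so some fiber has two
      distinct non-adjacent vertices and the distortion is at least [b]
      ([GH_lt_theta_le]); relating everything to everything
      has distortion at most [b], so [2 d_GH = b] exactly;
    - if [theta G <= k], a family of [k] cliques covering [V] is a relation of
      distortion at most [a], so [2 d_GH <= a < b].

    Hence [2 d_GH = b] exactly when [k < theta G] (for [k > 0] and [V]
    nonempty), and the largest such [k] is [(theta G).-1].

    The lower bound on [d_GH] reads a relation off an embedding into a common
    metric space ([GH_lt_correspondence]); the upper bound turns a relation
    into a metric on the disjoint union ([GH_le_cross], [simplex_GH_le]). *)

(** * The Gromov-Hausdorff distance *)

(** In an ambient space where the copies of [X] and [Y] are at Hausdorff
    distance less than [r], relate the points that are at distance less than
    [r]. The triangle inequality through two related pairs compares the two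
    metrics up to [2 r]. *)
Lemma GH_lt_correspondence (R : realType) (X Y : metricType R) (r : R) :
  (gromov_hausdorff_dist X Y < r%:E)%E ->
  exists S : X -> Y -> Prop,
    [/\ forall x, exists y, S x y, forall y, exists x, S x y &
        forall x x' y y', S x y -> S x' y' -> mdist y y' < mdist x x' + 2 * r].
Proof.
move=> /ereal_inf_lt[_ [s [Z [X' [Y' [[f fE <-] [g gE <-] dfg]]]] <-] sr].
have /ereal_inf_lt[_ [t [t0 fg gf] <-]] := le_lt_trans dfg sr.
rewrite lte_fin => tr.
exists (fun x y => mdist (f x) (g y) < r); split.
- move=> x; have [_ [y _ <-]] := fg (f x) (imageT f x).
  by rewrite ballEmdist /= metric_sym => fgt; exists y; exact: lt_trans fgt tr.
- move=> y; have [_ [x _ <-]] := gf (g y) (imageT g y).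
  by rewrite ballEmdist /= => fgt; exists x; exact: lt_trans fgt tr.
move=> x x' y y' /= xy xy'; rewrite -fE -gE.
have := metric_triangle (g y) (f x) (g y').
have := metric_triangle (f x) (f x') (g y').
rewrite (metric_sym (g y) (f x)); lra.
Qed.

(** The axioms that a distance between points of [X] and points of [Y] must
    satisfy to extend the two metrics to the disjoint union. *)
Record gluing (R : realType) (X Y : metricType R) := Gluing {
  cross : X -> Y -> R;
  cross_gt0 : forall x y, 0 < cross x y;
  cross_lel : forall x x' y, cross x y <= mdist x x' + cross x' y;
  cross_ler : forall x y y', cross x y <= cross x y' + mdist y' y;
  mdist_le_crossl : forall x x' y, mdist x x' <= cross x y + cross x' y;
  mdist_le_crossr : forall x y y', mdist y y' <= cross x y + cross x y' }.

Arguments cross {R X Y}.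

(** The gluing is an argument so that each one gets its own metric structure
    on the sum type. *)
Definition glued (R : realType) (X Y : metricType R) (c : gluing R X Y) : Type :=
  (X + Y)%type.

Section GluedMetric.
Context (R : realType) (X Y : metricType R) (c : gluing R X Y).
Local Notation T := (glued R X Y c).

HB.instance Definition _ := Choice.on T.

Definition glued_dist (u v : T) : R :=
  match u, v with
  | inl x, inl x' => mdist x x'
  | inl x, inr y => cross c x y
  | inr y, inl x => cross c x y
  | inr y, inr y' => mdist y y'
  end.

Lemma glued_distxx u : glued_dist u u = 0.
Proof. by case: u => x; exact: mdistxx. Qed.

Lemma glued_dist_eq0 u v : glued_dist u v = 0 -> u = v.
Proof.
case: u v => [x|y] [x'|y'] /=; try by move=> /mdist_positivity ->.
  by move=> c0; have := cross_gt0 _ _ _ c x y'; rewrite c0 ltxx.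
by move=> c0; have := cross_gt0 _ _ _ c x' y; rewrite c0 ltxx.
Qed.

Lemma glued_dist_sym u v : glued_dist u v = glued_dist v u.
Proof. by case: u v => [x|y] [x'|y'] //=; exact: metric_sym. Qed.

Lemma glued_dist_triangle v u w :
  glued_dist u w <= glued_dist u v + glued_dist v w.
Proof.
case: u v w => [x|x] [y|y] [z|z] /=; try exact: metric_triangle.
- exact: cross_lel.
- exact: mdist_le_crossl.
- exact: cross_ler.
- by rewrite metric_sym addrC; exact: cross_lel.
- exact: mdist_le_crossr.
- by rewrite addrC metric_sym; exact: cross_ler.
Qed.

HB.instance Definition _ := @isMetric.Build R T glued_dist
  glued_distxx glued_dist_eq0 glued_dist_sym glued_dist_triangle.

End GluedMetric.

Lemma GH_le_cross (R : realType) (X Y : metricType R) (c : gluing R X Y) (r : R) :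
  0 < r -> (forall x, exists y, cross c x y <= r) ->
  (forall y, exists x, cross c x y <= r) ->
  (gromov_hausdorff_dist X Y <= r%:E)%E.
Proof.
move=> r0 cX cY; apply: ereal_inf_lbound; exists r => //.
exists (glued R X Y c), (range inl), (range inr); split.
- by exists inl.
- by exists inr.
(* neighborhoods are made of open balls, so [r] itself need not be attained *)
apply/lee_addgt0Pr => e e0; rewrite -EFinD.
apply: ereal_inf_lbound; exists (r + e) => //; split.
- by rewrite addr_gt0.
- move=> _ [x _ <-]; have [y cxy] := cX x; exists (inr y); first exact: imageT.
  by rewrite ballEmdist /=; apply: le_lt_trans cxy _; rewrite ltrDl.
move=> _ [y _ <-]; have [x cxy] := cY y; exists (inl x); first exact: imageT.
by rewrite ballEmdist /=; apply: le_lt_trans cxy _; rewrite ltrDl.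
Qed.

(** * Clique covers *)

(** [theta G] is a minimum over sets of cliques, whereas the points of a
    simplex index a family with possible repetitions; repeating a clique is
    what makes the condition monotone in [k]. *)
Lemma theta_leP (G : sgraph) (k : nat) : (0 < k)%N -> (0 < #|G|)%N ->
  (theta G <= k)%N <->
  exists C : 'I_k -> {set G}, (forall i, clique (C i)) /\
                              (forall v, exists i, v \in C i).
Proof.
move=> k0 /card_gt0P[v0 _]; rewrite /theta; case: ex_minnP => t.
move=> /existsP[P /andP[/andP[/forall_inP clP /eqP covP] /eqP <-]] minP.
split=> [Pk | [C [clC covC]]].
  have /bigcupP[A0 A0P _] : v0 \in finset.cover P by rewrite covP finset.in_setT.
  (* past the end of [enum P], the clique [A0] is repeated *)
  exists (fun i => nth A0 (enum P) i); split=> [i|v].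
    apply: clP; case: (ltnP i (size (enum P))) => iP.
      by rewrite -mem_enum mem_nth.
    by rewrite nth_default.
  have /bigcupP[A AP vA] : v \in finset.cover P by rewrite covP finset.in_setT.
  have AE : A \in enum P by rewrite mem_enum.
  have Ak : (index A (enum P) < k)%N.
    by apply: leq_trans Pk; rewrite cardE index_mem.
  by exists (Ordinal Ak); rewrite nth_index.
apply: (@leq_trans #|[set C i | i : 'I_k]%SET|); last first.
  by rewrite -[leqRHS]card_ord; exact: leq_imset_card.
apply: minP; apply/existsP; exists [set C i | i : 'I_k]%SET.
rewrite eqxx andbT; apply/andP; split.
  by apply/forall_inP => _ /imsetP[i _ ->].
apply/eqP/setP => v; rewrite finset.in_setT; apply/bigcupP.
by have [i vi] := covC v; exists (C i) => //; exact: imset_f.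
Qed.

(** * Simplices and two-distance spaces *)

Section SimplexGraph.
Context (R : realType) (G : sgraph) (a b : R).
Context (a_gt0 : 0 < a) (ab : a < b <= 2 * a).
Local Notation V := (graph_space G a_gt0 ab).
Local Notation Delta := (simplex a_gt0).

Lemma graph_mdist_le (v w : V) : mdist v w <= b.
Proof.
rewrite /mdist /= /graph_dist; have /andP[? ?] := ab; have := a_gt0.
by case: eqP => _; [|case: ifP]; lra.
Qed.

Lemma graph_mdist_ge (v w : V) : v != w -> a <= mdist v w.
Proof.
rewrite /mdist /= /graph_dist => /negPf ->; have /andP[? ?] := ab.
by case: ifP; lra.
Qed.

Lemma graph_mdist_ltb (v w : V) :
  mdist v w < b <-> (v != w -> @adj G v w).
Proof.
rewrite /mdist /= /graph_dist; have /andP[? ?] := ab; have := a_gt0.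
case: (eqVneq v w) => [_ | _] ?; first by split=> // _; lra.
case: ifP => // _; split=> [|/(_ isT)] //; lra.
Qed.

Lemma graph_mdist_lea (v w : V) :
  (v != w -> @adj G v w) -> mdist v w <= a.
Proof.
rewrite /mdist /= /graph_dist; have := a_gt0.
by case: (eqVneq v w) => [_ | _] ? => [_|/(_ isT) ->]; lra.
Qed.

(** The gluing puts related points at distance [r] and unrelated ones at
    distance [r + a]: the gap [a] is at most every nonzero distance in both
    spaces, so moving an endpoint pays for it, and [2 r + a >= 2 a >= b] makes
    any two vertices not both related to a point satisfy the triangle
    inequality through that point. *)
Lemma simplex_GH_le {k : nat} (S : Delta k -> V -> bool) (r : R) :
  a <= 2 * r ->
  (forall i, exists v, S i v) -> (forall v, exists i, S i v) ->
  (forall i v w, S i v -> S i w -> mdist v w <= 2 * r) ->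
  (gromov_hausdorff_dist (Delta k) V <= r%:E)%E.
Proof.
move=> ar SD SV Sdiam; have a0 := a_gt0; have /andP[ab1 ab2] := ab.
pose c i v := if S i v then r else r + a.
have c_gt0 i v : 0 < c i v by rewrite /c; case: ifP; lra.
have c_lel i j v : c i v <= mdist i j + c j v.
  rewrite {1}/mdist /= /simplex_dist; case: eqVneq => [->|_]; first by lra.
  by rewrite /c; case: (S i v); case: (S j v); lra.
have c_ler i v w : c i v <= c i w + mdist w v.
  have [->|/graph_mdist_ge wv] := eqVneq w v; first by rewrite mdistxx; lra.
  by rewrite /c; case: (S i v); case: (S i w); lra.
have c_cl i j v : mdist i j <= c i v + c j v.
  rewrite /mdist /= /simplex_dist /c.
  by case: eqP => _; case: (S i v); case: (S j v); lra.
have c_cr i v w : mdist v w <= c i v + c i w.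
  have := graph_mdist_le v w; rewrite /c.
  case: ifP => Siv; case: ifP => Siw; try lra.
  by have := Sdiam i v w Siv Siw; lra.
apply: (@GH_le_cross _ _ _ (Gluing _ _ _ c c_gt0 c_lel c_ler c_cl c_cr)).
- by lra.
- by move=> i; have [v Siv] := SD i; exists v; rewrite /= /c Siv.
- by move=> v; have [i Siv] := SV v; exists i; rewrite /= /c Siv.
Qed.

(** The fibers of a relation of distortion less than [b] are cliques. *)
Lemma GH_lt_theta_le (k : nat) : (0 < k)%N -> (0 < #|G|)%N ->
  (gromov_hausdorff_dist (Delta k) V < (b / 2)%:E)%E -> (theta G <= k)%N.
Proof.
move=> k0 G0 /GH_lt_correspondence[S [SD SV Sdist]]; apply/theta_leP => //.
exists (fun i => [set v : G | `[< S i v >]]%SET); split=> [i|v]; last first.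
  by have [i Siv] := SV v; exists i; rewrite finset.inE; exact/asboolP.
apply/andP; split.
  have [v Siv] := SD i; apply/set0Pn; exists v.
  by rewrite finset.inE; exact/asboolP.
apply/forall_inP => v; rewrite finset.inE => /asboolP Siv.
apply/forall_inP => w; rewrite finset.inE => /asboolP Siw.
apply/implyP/graph_mdist_ltb; have := Sdist _ _ _ _ Siv Siw.
by rewrite mdistxx; lra.
Qed.

Lemma simplex_GH_eq (k : nat) : (0 < k)%N -> (0 < #|G|)%N ->
  gromov_hausdorff_dist (Delta k) V = (b / 2)%:E <-> (k < theta G)%N.
Proof.
move=> k0 G0; have a0 := a_gt0; have /andP[ab1 ab2] := ab.
split=> [GHE | kt].
  rewrite ltnNge; apply/negP => /theta_leP[//|//|C [clC covC]].
  have : (gromov_hausdorff_dist (Delta k) V <= (a / 2)%:E)%E.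
    apply: (@simplex_GH_le _ (fun i v => v \in C i)).
    - by lra.
    - by move=> i; have /andP[/set0Pn] := clC i.
    - exact: covC.
    move=> i v w vi wi; have -> : 2 * (a / 2) = a by lra.
    apply: graph_mdist_lea; apply/implyP.
    by have /andP[_ /forall_inP/(_ v vi)/forall_inP/(_ w wi)] := clC i.
  by rewrite GHE lee_fin; lra.
apply/eqP; rewrite eq_le; apply/andP; split.
  have /card_gt0P[v0 _] := G0.
  apply: (@simplex_GH_le _ (fun _ _ => true)).
  - by lra.
  - by exists v0.
  - by exists (Ordinal k0).
  by move=> _ v w _ _; have := graph_mdist_le v w; lra.
rewrite leNgt; apply/negP => /GH_lt_theta_le-/(_ k0 G0).
by rewrite leqNgt kt.
Qed.

(** The distance from a nonempty space to the empty one is infinite. *)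
Lemma simplex_GH_lt_card (k : nat) (r : R) : (0 < k)%N ->
  (gromov_hausdorff_dist (Delta k) V < r%:E)%E -> (0 < #|G|)%N.
Proof.
move=> k0 /GH_lt_correspondence[S [SD _ _]].
by have [v _] := SD (Ordinal k0); apply/card_gt0P; exists v.
Qed.

End SimplexGraph.

Lemma mule2_eq_fin (R : realType) (x : \bar R) (b : R) :
  (2%:E * x = b%:E)%E <-> x = (b / 2)%:E.
Proof.
split=> [|->]; last by rewrite -EFinM; congr EFin; lra.
case: x => [x||]; last 2 first.
- by rewrite gt0_muley // lte_fin.
- by rewrite gt0_muleNy // lte_fin.
by rewrite -EFinM => -[xb]; congr EFin; lra.
Qed.

Theorem corollary2p14 (R : realType) (G : sgraph) (a b : R)
  (a_gt0 : 0 < a) (ab : a < b <= 2 * a) (m : nat)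
  (m_gt0 : (0 < m)%N)
  (hm : (2%:E * gromov_hausdorff_dist (simplex a_gt0 m) (graph_space G a_gt0 ab)
         = b%:E)%E)
  (m_max : forall k : nat, (0 < k)%N ->
     (2%:E * gromov_hausdorff_dist (simplex a_gt0 k) (graph_space G a_gt0 ab)
      = b%:E)%E -> (k <= m)%N) :
  theta G = m.+1.
Proof.
have /mule2_eq_fin hm2 := hm.
have G0 : (0 < #|G|)%N.
  apply: (@simplex_GH_lt_card _ _ _ _ a_gt0 ab m b m_gt0).
  by rewrite hm2 lte_fin; have /andP[? ?] := ab; lra.
have mt : (m < theta G)%N by apply/(simplex_GH_eq R G a b a_gt0 ab).
apply/eqP; rewrite eqn_leq mt andbT leqNgt; apply/negP => m1t.
suff : (m.+1 <= m)%N by rewrite ltnn.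
by apply: m_max => //; apply/mule2_eq_fin/(simplex_GH_eq R G a b a_gt0 ab).
Qed.
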